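(* Let $A$ be a finite alphabet and let $(X,c)$ be an $\hat F$-coalgebra whose carrier $X$ is a compact subset of $\mathbb R^n$ with $\Delta^n\subseteq X\subseteq\mathbb R_+^n$. Write $c(x)=(c_o(x),(c_a(x))_{a\in A})$ and let $e_j$ denote the $j$-th canonical basis vector of $\mathbb R^n$. Assume there is no nonempty $I\subseteq\{1,\dots,n\}$ such that $c_o(e_j)=0$ for all $j\in I$ and $c_a(e_j)\in\operatorname{span}\{e_i\mid i\in I\}$ for all $a\in A$, $j\in I$. Then there exists an $\hat F$-coalgebra $(Y,d)$ with $X\subseteq Y\subseteq\mathbb R_+^n$ such that the inclusion map $X\to Y$ is an $\hat F$-coalgebra morphism and $Y$ is the subconvex hull of $n$ linearly independent vectors (in particular $Y$ is free with $n$ generators).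
   Context: Positively convex algebras are algebras for the finitely supported subprobability distribution monad; a subset of $\mathbb R^n$ is one iff it is convex and contains $0$; morphisms are maps preserving subconvex combinations $\sum p_ix_i$ ($p_i\ge0,\sum p_i\le1$). $\Delta^n=\{\xi\in\mathbb R^n\mid \xi_j\ge0,\sum_j\xi_j\le1\}$ is the free one on $n$ generators. The subconvex hull of a set is the set of its subconvex combinations. The functor $\hat F$: $\hat F X=\{(o,\phi)\in[0,1]\times X^A\mid \exists\,n_a\in\mathbb N,\ p_{a,j}\in[0,1],\ x_{a,j}\in X:\ o+\sum_a\sum_{j=1}^{n_a}p_{a,j}\le1,\ \phi(a)=\sum_{j=1}^{n_a}p_{a,j}x_{a,j}\}$, $\hat F f=\mathrm{id}_{[0,1]}\times(f\circ-)$. An $\hat F$-coalgebra is a positively convex algebra $X$ with a morphism $c\colon X\to\hat F X$; a coalgebra morphism $f\colon(X,c)\to(Y,d)$ is a morphism with $d\circ f=\hat F f\circ c$. *)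

(* Defs.v *)
From HB Require Import structures.
From mathcomp Require Import all_boot all_order all_algebra.
From mathcomp Require Import all_classical all_reals all_analysis.

Set Implicit Arguments.
Unset Strict Implicit.
Unset Printing Implicit Defensive.

Import Order.TTheory GRing.Theory Num.Theory.

Local Open Scope classical_set_scope.
Local Open Scope ring_scope.

Section Subprob.
Variable R : realType.

Record subprob (n : nat) := Subprob {
  sp_val :> 'I_n -> R;
  sp_ge0 : forall i, 0 <= sp_val i;
  sp_le1 : \sum_i sp_val i <= 1 }.

Lemma subprob_eq n (p q : subprob n) : p =1 q -> p = q.
Proof.
case: p => p p0 p1; case: q => q q0 q1 /= /funext E.
move: q0 q1; rewrite -E => q0 q1.
by congr Subprob; apply: Prop_irrelevance.
Qed.

Lemma sp_sum_le1 n (p : subprob n) (F : 'I_n -> R) :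
  (forall i, F i <= 1) -> \sum_i p i * F i <= 1.
Proof.
move=> F1; apply: le_trans (sp_le1 p); apply: ler_sum => i _.
by rewrite ler_piMr ?sp_ge0.
Qed.

Fact sp_dirac_ge0 n (k i : 'I_n) : 0 <= (i == k)%:R :> R.
Proof. by rewrite ler0n. Qed.

Fact sp_dirac_le1 n (k : 'I_n) : \sum_i (i == k)%:R <= 1 :> R.
Proof.
by rewrite (bigD1 k) //= eqxx big1 ?addr0 // => i /negPf ->.
Qed.

Definition sp_dirac n (k : 'I_n) : subprob n :=
  Subprob (sp_dirac_ge0 k) (sp_dirac_le1 k).

Fact sp_bind_ge0 n m (p : subprob n) (q : 'I_n -> subprob m) j :
  0 <= \sum_i p i * q i j.
Proof. by apply: sumr_ge0 => i _; rewrite mulr_ge0 ?sp_ge0. Qed.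

Fact sp_bind_le1 n m (p : subprob n) (q : 'I_n -> subprob m) :
  \sum_j \sum_i p i * q i j <= 1.
Proof.
rewrite exchange_big /=; under eq_bigr do rewrite -mulr_sumr.
by apply: sp_sum_le1 => i; exact: sp_le1.
Qed.

Definition sp_bind n m (p : subprob n) (q : 'I_n -> subprob m) : subprob m :=
  Subprob (sp_bind_ge0 p q) (sp_bind_le1 p q).

End Subprob.

(* Algebras of the finitely supported subprobability distribution monad,
   presented by the operations (x_1, ..., x_n) |-> sum_i p_i x_i: pca_unit is
   the unit law of the Eilenberg-Moore algebra and pca_bary is the
   multiplication law. *)
Record pca (R : realType) := Pca {
  pca_sort :> Type;
  subconv : forall n, subprob R n -> ('I_n -> pca_sort) -> pca_sort;
  pca_unit : forall n (k : 'I_n) (x : 'I_n -> pca_sort),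
    subconv (sp_dirac R k) x = x k;
  pca_bary : forall n m (p : subprob R n) (q : 'I_n -> subprob R m)
      (x : 'I_m -> pca_sort),
    subconv p (fun i => subconv (q i) x) = subconv (sp_bind p q) x }.

Record pca_hom (R : realType) (X Y : pca R) := PcaHom {
  hom_fun :> X -> Y;
  homP : forall n (p : subprob R n) (x : 'I_n -> X),
    hom_fun (subconv p x) = subconv p (fun i => hom_fun (x i)) }.

Section PcaConstructions.
Variable R : realType.

(* Y is free on the family g. *)
Definition free_on (Y : pca R) (n : nat) (g : 'I_n -> Y) : Prop :=
  forall (Z : pca R) (h : 'I_n -> Z),
    (exists f : pca_hom Y Z, forall i, f (g i) = h i) /\
    (forall f f' : pca_hom Y Z,
      (forall i, f (g i) = h i) -> (forall i, f' (g i) = h i) -> f =1 f').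

Section Lmod.
Variable V : lmodType R.

Definition lmod_subconv n (p : subprob R n) (x : 'I_n -> V) : V :=
  \sum_i p i *: x i.

Fact lmod_unit n (k : 'I_n) (x : 'I_n -> V) :
  lmod_subconv (sp_dirac R k) x = x k.
Proof.
rewrite /lmod_subconv (bigD1 k) //= eqxx scale1r big1 ?addr0 // => i /negPf ->.
by rewrite scale0r.
Qed.

Fact lmod_bary n m (p : subprob R n) (q : 'I_n -> subprob R m) (x : 'I_m -> V) :
  lmod_subconv p (fun i => lmod_subconv (q i) x) = lmod_subconv (sp_bind p q) x.
Proof.
rewrite /lmod_subconv /=; under eq_bigr do rewrite scaler_sumr.
rewrite exchange_big /=; apply: eq_bigr => j _.
by rewrite scaler_suml; apply: eq_bigr => i _; rewrite scalerA.
Qed.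

Definition lmod_pca : pca R := Pca lmod_unit lmod_bary.

End Lmod.

Section Prod.
Variables X Y : pca R.

Definition prod_subconv n (p : subprob R n) (x : 'I_n -> X * Y) : X * Y :=
  (subconv p (fun i => (x i).1), subconv p (fun i => (x i).2)).

Fact prod_unit n (k : 'I_n) (x : 'I_n -> X * Y) :
  prod_subconv (sp_dirac R k) x = x k.
Proof. by rewrite /prod_subconv !pca_unit -surjective_pairing. Qed.

Fact prod_bary n m (p : subprob R n) (q : 'I_n -> subprob R m)
    (x : 'I_m -> X * Y) :
  prod_subconv p (fun i => prod_subconv (q i) x) = prod_subconv (sp_bind p q) x.
Proof. by rewrite /prod_subconv /= !pca_bary. Qed.

Definition prod_pca : pca R := Pca prod_unit prod_bary.

End Prod.

Section Power.
Variables (A : Type) (X : pca R).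

Definition pow_subconv n (p : subprob R n) (x : 'I_n -> A -> X) : A -> X :=
  fun a => subconv p (fun i => x i a).

Fact pow_unit n (k : 'I_n) (x : 'I_n -> A -> X) :
  pow_subconv (sp_dirac R k) x = x k.
Proof. by apply/funext => a; rewrite /pow_subconv pca_unit. Qed.

Fact pow_bary n m (p : subprob R n) (q : 'I_n -> subprob R m)
    (x : 'I_m -> A -> X) :
  pow_subconv p (fun i => pow_subconv (q i) x) = pow_subconv (sp_bind p q) x.
Proof. by apply/funext => a; rewrite /pow_subconv pca_bary. Qed.

Definition pow_pca : pca R := Pca pow_unit pow_bary.

End Power.

Section Sub.
Variable P : pca R.

Definition subconv_closed (S : set P) : Prop :=
  forall n (p : subprob R n) (x : 'I_n -> P),
    (forall i, S (x i)) -> S (subconv p x).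

Variables (S : set P) (hS : subconv_closed S).

Definition sub_subconv n (p : subprob R n) (x : 'I_n -> S) : S :=
  exist (fun y => y \in S) (subconv p (fun i => val (x i)))
    (mem_set (hS p (fun i => set_mem (valP (x i))))).

Fact sub_unit n (k : 'I_n) (x : 'I_n -> S) :
  sub_subconv (sp_dirac R k) x = x k.
Proof. by apply: val_inj; rewrite /= pca_unit. Qed.

Fact sub_bary n m (p : subprob R n) (q : 'I_n -> subprob R m) (x : 'I_m -> S) :
  sub_subconv p (fun i => sub_subconv (q i) x) = sub_subconv (sp_bind p q) x.
Proof. by apply: val_inj; rewrite /= pca_bary. Qed.

Definition sub_pca : pca R := Pca sub_unit sub_bary.

End Sub.

End PcaConstructions.

Section Fhat.
Variables (R : realType) (A : finType).

Definition Fhat_set (X : pca R) : set (prod_pca (lmod_pca R^o) (pow_pca A X)) :=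
  [set u | 0 <= (u.1 : R) <= 1 /\
    exists (k : A -> nat) (p : forall a, subprob R (k a))
           (x : forall a, 'I_(k a) -> X),
      (u.1 : R) + \sum_a \sum_j p a j <= 1 /\
      forall a, u.2 a = subconv (p a) (x a)].

Lemma subconv_flatten (X : pca R) n (q : subprob R n) (k : 'I_n -> nat)
    (p : forall i, subprob R (k i)) (x : forall i, 'I_(k i) -> X) :
  exists (m : nat) (r : subprob R m) (y : 'I_m -> X),
    \sum_j r j = \sum_i q i * \sum_j p i j /\
    subconv q (fun i => subconv (p i) (x i)) = subconv r y.
Proof.
pose J : finType := {i : 'I_n & 'I_(k i)}.
pose y (l : 'I_#|J|) : X := x (tag (enum_val l)) (tagged (enum_val l)).
pose rk i (j : 'I_(k i)) : 'I_#|J| := enum_rank (Tagged (fun i => 'I_(k i)) j).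
pose s i : subprob R #|J| := sp_bind (p i) (fun j => sp_dirac R (rk i j)).
exists #|J|, (sp_bind q s), y; split.
  rewrite /= exchange_big /=; apply: eq_bigr => i _.
  rewrite -mulr_sumr; congr (_ * _); rewrite exchange_big /=.
  apply: eq_bigr => j _; rewrite -mulr_sumr (bigD1 (rk i j)) //= eqxx.
  by rewrite big1 ?addr0 ?mulr1 // => l /negPf ->.
rewrite -pca_bary; congr subconv; apply/funext => i.
rewrite -pca_bary; congr subconv; apply/funext => j.
by rewrite pca_unit /y /rk enum_rankK.
Qed.

Lemma Fhat_closed (X : pca R) : subconv_closed (@Fhat_set X).
Proof.
move=> n q u hu.
have hub i : 0 <= ((u i).1 : R) <= 1 by case: (hu i).
have /choice[k hk] : forall i, exists k : A -> nat,
    exists (p : forall a, subprob R (k a)) (x : forall a, 'I_(k a) -> X),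
      ((u i).1 : R) + \sum_a \sum_j p a j <= 1 /\
      forall a, (u i).2 a = subconv (p a) (x a).
  by move=> i; case: (hu i).
pose p i := sval (cid (hk i)).
have hp i : exists x : forall a, 'I_(k i a) -> X,
      ((u i).1 : R) + \sum_a \sum_j p i a j <= 1 /\
      forall a, (u i).2 a = subconv (p i a) (x a) by exact: svalP (cid (hk i)).
pose x i := sval (cid (hp i)).
have hx i : ((u i).1 : R) + \sum_a \sum_j p i a j <= 1 /\
    forall a, (u i).2 a = subconv (p i a) (x i a) by exact: svalP (cid (hp i)).
split.
  apply/andP; split.
    by apply: sumr_ge0 => i _; rewrite mulr_ge0 ?sp_ge0 //; case/andP: (hub i).
  by apply: sp_sum_le1 => i; case/andP: (hub i).
have fl a := subconv_flatten q (fun i => p i a) (fun i => x i a).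
pose m a := sval (cid (fl a)).
have fl1 a : exists (r : subprob R (m a)) (y : 'I_(m a) -> X),
    \sum_j r j = \sum_i q i * \sum_j p i a j /\
    subconv q (fun i => subconv (p i a) (x i a)) = subconv r y.
  exact: svalP (cid (fl a)).
pose r a := sval (cid (fl1 a)).
have fl2 a : exists y : 'I_(m a) -> X,
    \sum_j r a j = \sum_i q i * \sum_j p i a j /\
    subconv q (fun i => subconv (p i a) (x i a)) = subconv (r a) y.
  exact: svalP (cid (fl1 a)).
pose y a := sval (cid (fl2 a)).
have hy a : \sum_j r a j = \sum_i q i * \sum_j p i a j /\
    subconv q (fun i => subconv (p i a) (x i a)) = subconv (r a) (y a).
  exact: svalP (cid (fl2 a)).
exists m, r, y; split.
  under [X in _ + X <= _]eq_bigr do rewrite (hy _).1.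
  rewrite exchange_big /=; under [X in _ + X <= _]eq_bigr do rewrite -mulr_sumr.
  rewrite /lmod_subconv -big_split /=.
  under eq_bigr do rewrite -[_ *: _]/(_ * _) -mulrDr.
  by apply: sp_sum_le1 => i; case: (hx i).
move=> a; rewrite -(hy a).2; congr subconv; apply/funext => i.
by rewrite (hx i).2.
Qed.

Definition Fhat (X : pca R) : pca R := sub_pca (@Fhat_closed X).

Definition Fhat_out (X : pca R) (u : Fhat X) : R := (val u).1.
Definition Fhat_next (X : pca R) (u : Fhat X) (a : A) : X := (val u).2 a.

Section FhatMap.
Variables (X Y : pca R) (f : pca_hom X Y).

Fact Fhat_map_subproof (u : Fhat X) :
  Fhat_set ((Fhat_out u, fun a => f (Fhat_next u a)) :
             prod_pca (lmod_pca R^o) (pow_pca A Y)).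
Proof.
case: (set_mem (valP u)) => h0 [k [p [x [h1 h2]]]]; split => //.
exists k, p, (fun a j => f (x a j)); split=> //= a.
by rewrite -homP -h2.
Qed.

Definition Fhat_fun (u : Fhat X) : Fhat Y :=
  exist (fun w => w \in @Fhat_set Y) _ (mem_set (Fhat_map_subproof u)).

Fact Fhat_fun_hom n (p : subprob R n) (u : 'I_n -> Fhat X) :
  Fhat_fun (subconv p u) = subconv p (fun i => Fhat_fun (u i)).
Proof.
apply: val_inj => /=; congr pair; apply/funext => a.
by rewrite /Fhat_next /= homP.
Qed.

Definition Fhat_map : pca_hom (Fhat X) (Fhat Y) := PcaHom Fhat_fun_hom.

End FhatMap.

Definition coalg_morph (X Y : pca R) (c : pca_hom X (Fhat X))
    (d : pca_hom Y (Fhat Y)) (f : pca_hom X Y) : Prop :=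
  forall x, d (f x) = Fhat_map f (c x).

End Fhat.

Section Euclidean.
Variables (R : realType) (n : nat).

Definition Rn_pca : pca R := lmod_pca 'rV[R]_n.

Definition ebase (j : 'I_n) : 'rV[R]_n := delta_mx 0 j.

Definition orthant : set 'rV[R]_n := [set x | forall j, 0 <= x 0 j].

Definition simplex : set 'rV[R]_n :=
  [set x | (forall j, 0 <= x 0 j) /\ \sum_j x 0 j <= 1].

Lemma ebase_simplex j : simplex (ebase j).
Proof.
split=> [i|]; first by rewrite mxE eqxx ler0n.
rewrite (bigD1 j) //= mxE !eqxx big1 ?addr0 // => i /negPf ij.
by rewrite mxE ij.
Qed.

Definition subconvex_hull (S : set 'rV[R]_n) : set 'rV[R]_n :=
  [set y | exists (m : nat) (p : subprob R m) (x : 'I_m -> 'rV[R]_n),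
    (forall i, S (x i)) /\ y = \sum_i p i *: x i].

Definition ebase_in (X : set 'rV[R]_n) (hX : subconv_closed (P := Rn_pca) X)
    (hD : simplex `<=` X) (j : 'I_n) : sub_pca hX :=
  exist (fun x => x \in X) (ebase j) (mem_set (hD _ (ebase_simplex j))).

Section Inclusion.
Variables (X Y : set 'rV[R]_n) (hX : subconv_closed (P := Rn_pca) X)
  (hY : subconv_closed (P := Rn_pca) Y) (hXY : X `<=` Y).

Definition sub_incl_fun (x : sub_pca hX) : sub_pca hY :=
  exist (fun y => y \in Y) (val x) (mem_set (hXY (set_mem (valP x)))).

Fact sub_incl_hom m (p : subprob R m) (x : 'I_m -> sub_pca hX) :
  sub_incl_fun (subconv p x) = subconv p (fun i => sub_incl_fun (x i)).
Proof. exact: val_inj. Qed.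

Definition sub_incl : pca_hom (sub_pca hX) (sub_pca hY) := PcaHom sub_incl_hom.

End Inclusion.

End Euclidean.

Arguments orthant R n : clear implicits.
Arguments simplex R n : clear implicits.
Arguments sub_incl {R n X Y} hX hY hXY.

(* Main.v *)
Require Import Defs.
From HB Require Import structures.
From mathcomp Require Import all_boot all_order all_algebra.
From mathcomp Require Import all_classical all_reals all_analysis.
Import Order.TTheory GRing.Theory Num.Theory.
Import numFieldNormedType.Exports.
Local Open Scope classical_set_scope.
Local Open Scope ring_scope.

(** Since cone(X) is the whole orthant, c is the restriction of a linear map
    given by b_j = c_o(e_j) and C_{a,j} = c_a(e_j), and Y must have the form
    { x >= 0 | <u, x> <= 1 } with u > 0. Such a Y carries the linear extension
    of c as soon as T u <= u, where (T u)_j = b_j + sum_a <u, C_{a,j}>, and it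
    contains X as soon as <u, x> <= 1 on X. The defining condition of
    \hat F X says precisely that T preserves the latter bound, so the iterates
    T^k 0 satisfy it; they increase to a fixed point u of T, which satisfies it
    too. Finally I = { j | u_j = 0 } is one of the sets excluded by
    assumption unless it is empty. *)

(** * Simplices cut out of the orthant by one linear inequality, and their freeness *)

Section WeightedSimplex.
Context {R : realType} {n : nat}.
Implicit Types (u : 'I_n -> R) (x y : 'rV[R]_n).

Definition pairing u x : R := \sum_j u j * x 0 j.

Definition weighted_simplex u : set 'rV[R]_n :=
  [set x | orthant R n x /\ pairing u x <= 1].

Lemma pairing_sum u m (p : 'I_m -> R) (x : 'I_m -> 'rV[R]_n) :
  pairing u (\sum_i p i *: x i) = \sum_i p i * pairing u (x i).
Proof.
rewrite /pairing; under [RHS]eq_bigr do rewrite mulr_sumr.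
rewrite exchange_big /=; apply: eq_bigr => j _.
rewrite summxE mulr_sumr; apply: eq_bigr => i _.
by rewrite mxE mulrCA.
Qed.

Lemma ler_pairing u u' x : orthant R n x -> (forall j, u j <= u' j) ->
  pairing u x <= pairing u' x.
Proof. by move=> x0 uu'; apply: ler_sum => j _; rewrite ler_wpM2r. Qed.

Lemma pairing_ge0 u x : (forall j, 0 <= u j) -> orthant R n x ->
  0 <= pairing u x.
Proof. by move=> u0 x0; apply: sumr_ge0 => j _; rewrite mulr_ge0. Qed.

Lemma row_sum_ebase x : x = \sum_j x 0 j *: ebase R j.
Proof. exact: row_sum_delta. Qed.

Lemma pairing_ebase u j : pairing u (ebase R j) = u j.
Proof.
rewrite /pairing (bigD1 j) //= mxE !eqxx mulr1 big1 ?addr0 // => i /negPf ij.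
by rewrite mxE ij mulr0.
Qed.

Lemma orthant_sum m (p : 'I_m -> R) (x : 'I_m -> 'rV[R]_n) :
  (forall i, 0 <= p i) -> (forall i, orthant R n (x i)) ->
  orthant R n (\sum_i p i *: x i).
Proof.
move=> p0 x0 j; rewrite summxE; apply: sumr_ge0 => i _.
by rewrite mxE mulr_ge0 //; exact: x0.
Qed.

Lemma weighted_simplex_closed u :
  subconv_closed (P := Rn_pca R n) (weighted_simplex u).
Proof.
move=> m p x hx; split.
  by apply: orthant_sum => [i|i]; [exact: sp_ge0|exact: (hx i).1].
by rewrite pairing_sum; apply: sp_sum_le1 => i; exact: (hx i).2.
Qed.

Section Positive.
Variables (u : 'I_n -> R) (u_gt0 : forall j, 0 < u j).

Let Y : pca R := sub_pca (weighted_simplex_closed u).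

(** The point where the hyperplane <u, x> = 1 meets the i-th coordinate axis. *)
Definition vertex (i : 'I_n) : 'rV[R]_n := (u i)^-1 *: ebase R i.

Lemma vertexP i : weighted_simplex u (vertex i).
Proof.
split=> [j|]; first by rewrite !mxE mulr_ge0 ?ler0n // invr_ge0 ltW.
have := pairing_sum u 1 (fun=> (u i)^-1) (fun=> ebase R i).
by rewrite !big_ord1 pairing_ebase => ->; rewrite mulVf ?gt_eqF.
Qed.

Definition vertex_in (i : 'I_n) : Y :=
  exist (fun y => y \in weighted_simplex u) _ (mem_set (vertexP i)).

Lemma sum_vertex x : \sum_i (u i * x 0 i) *: vertex i = x.
Proof.
rewrite [RHS]row_sum_ebase; apply: eq_bigr => i _.
by rewrite scalerA mulrAC divff ?mul1r ?gt_eqF.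
Qed.

Lemma free_vertex : free [tuple vertex i | i < n].
Proof.
have vE (i : 'I_n) : [tuple vertex i | i < n]`_i = vertex i.
  by rewrite -tnth_nth tnth_mktuple.
apply/freeP => k k0 i; move/rowP/(_ i): k0; rewrite summxE mxE (bigD1 i) //=.
rewrite vE big1 => [|j ji]; last by rewrite vE !mxE eqxx eq_sym (negPf ji) !mulr0.
move/eqP; rewrite !mxE !eqxx mulr1 addr0 mulf_eq0 invr_eq0.
by rewrite (gt_eqF (u_gt0 i)) orbF => /eqP.
Qed.

Lemma sub_weighted_simplex (y : Y) : weighted_simplex u (val y).
Proof. exact: set_mem (valP y). Qed.

Lemma coord_ge0 (y : Y) i : 0 <= u i * val y 0 i.
Proof. by rewrite mulr_ge0 ?(ltW (u_gt0 i)) ?(sub_weighted_simplex y).1. Qed.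

(** Barycentric coordinates with respect to the vertices. Their total mass is [pairing u y], so the
    inequality defining Y is the subprobability condition. *)
Definition coord_subprob (y : Y) : subprob R n :=
  Subprob (coord_ge0 y) (sub_weighted_simplex y).2.

Lemma coord_subprobK (y : Y) : subconv (coord_subprob y) vertex_in = y.
Proof. by apply: val_inj; exact: sum_vertex. Qed.

Lemma coord_subprob_bind m (p : subprob R m) (x : 'I_m -> Y) :
  coord_subprob (subconv p x) = sp_bind p (fun i => coord_subprob (x i)).
Proof.
apply: subprob_eq => j /=; rewrite summxE mulr_sumr; apply: eq_bigr => i _.
by rewrite mxE mulrCA.
Qed.

Lemma coord_subprob_vertex i : coord_subprob (vertex_in i) = sp_dirac R i.
Proof.
apply: subprob_eq => j /=; rewrite !mxE eqxx /=.
by case: eqVneq => [->|_]; rewrite ?mulr0 // mulr1 divff ?gt_eqF.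
Qed.

(** Every point is the combination of the vertices given by its coordinates, which forces the
    extension of [h]. Coordinates commute with subconvex combinations, so the multiplication law
    makes this extension a morphism. *)
Lemma free_on_vertex : free_on vertex_in.
Proof.
move=> Z h; split.
  pose f (y : Y) : Z := subconv (coord_subprob y) h.
  have fP m (p : subprob R m) (x : 'I_m -> Y) :
      f (subconv p x) = subconv p (fun i => f (x i)).
    by rewrite /f pca_bary coord_subprob_bind.
  by exists (PcaHom fP) => i /=; rewrite /f coord_subprob_vertex pca_unit.
move=> f f' fh f'h y; rewrite -(coord_subprobK y) !homP.
by congr subconv; apply/funext => i; rewrite fh f'h.
Qed.

Lemma subconvex_hull_vertex :
  weighted_simplex u = subconvex_hull [set` [tuple vertex i | i < n]].
Proof.
apply/seteqP; split=> [y Yy|_ [m [p [x [xv ->]]]]].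
  pose y' : Y := exist (fun y => y \in weighted_simplex u) y (mem_set Yy).
  exists n, (coord_subprob y'), vertex; split; last by rewrite sum_vertex.
  by move=> i /=; rewrite map_f ?mem_enum.
apply: weighted_simplex_closed => i.
by have /= /mapP[j _ ->] := xv i; exact: vertexP.
Qed.

End Positive.
End WeightedSimplex.

(** * Morphisms from X into a module are restrictions of linear maps *)

Section LinearExtension.
Context {R : realType} {n : nat} {X : set 'rV[R]_n}.
Variables (hX : subconv_closed (P := Rn_pca R n) X) (hD : simplex R n `<=` X).
Hypothesis hP : X `<=` orthant R n.

(* A point of X may have coordinate sum > 1, so it is first scaled into the
   simplex, where it is a subconvex combination of the basis vectors. *)
Lemma pca_hom_linear (V : lmodType R) (g : pca_hom (sub_pca hX) (lmod_pca V))
    (x : sub_pca hX) :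
  g x = \sum_j val x 0 j *: (g (ebase_in hX hD j) : V) :> V.
Proof.
have x0 j : 0 <= val x 0 j by apply: hP; exact: set_mem (valP x).
pose s : R := 1 + \sum_j val x 0 j.
have s_ge1 : 1 <= s by rewrite lerDl sumr_ge0.
have s_gt0 : 0 < s by exact: lt_le_trans s_ge1.
have p0 (i : 'I_1) : 0 <= s^-1 by rewrite invr_ge0 ltW.
have p1 : \sum_(i < 1) s^-1 <= 1 by rewrite big_ord1 invf_le1.
have q0 j : 0 <= s^-1 * val x 0 j by rewrite mulr_ge0 // invr_ge0 ltW.
have q1 : \sum_j s^-1 * val x 0 j <= 1.
  by rewrite -mulr_sumr mulrC ler_pdivrMr // mul1r lerDr.
have E : subconv (Subprob p0 p1) (fun=> x) =
         subconv (Subprob q0 q1) (ebase_in hX hD).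
  apply: val_inj; rewrite /= /lmod_subconv /= big_ord1.
  rewrite [in LHS](row_sum_ebase (val x)) scaler_sumr.
  by apply: eq_bigr => j _; rewrite scalerA.
have := congr1 g E; rewrite !homP /= /lmod_subconv /= big_ord1 => gE.
apply: (@scalerI _ _ s^-1); first by rewrite invr_neq0 ?gt_eqF.
by rewrite gE scaler_sumr; apply: eq_bigr => j _; rewrite scalerA.
Qed.

End LinearExtension.

(** * Output and successors of the given coalgebra *)

Section Observation.
Context {R : realType} {A : finType} {n : nat} {X : set 'rV[R]_n}.
Context {hX : subconv_closed (P := Rn_pca R n) X}.
Variable c : pca_hom (sub_pca hX) (Fhat A (sub_pca hX)).

(** The components of [c] are viewed with values in modules, so that [pca_hom_linear] applies to
    them. *)
Definition coalg_out (x : sub_pca hX) : lmod_pca R^o := Fhat_out (c x).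

Definition coalg_next a (x : sub_pca hX) : Rn_pca R n := val (Fhat_next (c x) a).

Fact coalg_out_hom m (p : subprob R m) (x : 'I_m -> sub_pca hX) :
  coalg_out (subconv p x) = subconv p (fun i => coalg_out (x i)).
Proof. by rewrite /coalg_out homP. Qed.

Fact coalg_next_hom a m (p : subprob R m) (x : 'I_m -> sub_pca hX) :
  coalg_next a (subconv p x) = subconv p (fun i => coalg_next a (x i)).
Proof. by rewrite /coalg_next homP. Qed.

Definition out_hom : pca_hom (sub_pca hX) (lmod_pca R^o) :=
  PcaHom coalg_out_hom.

Definition next_hom a : pca_hom (sub_pca hX) (Rn_pca R n) :=
  PcaHom (coalg_next_hom a).

(** A successor is a combination of points of X, on which [pairing u] is at most 1, so its pairing
    is at most the mass of its weights; output and all masses together are at most 1. *)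
Lemma Fhat_pairing_le1 (u : 'I_n -> R) (z : Fhat A (sub_pca hX)) :
  (forall x, X x -> pairing u x <= 1) ->
  Fhat_out z + \sum_a pairing u (val (Fhat_next z a)) <= 1.
Proof.
move=> uX; case: (set_mem (valP z)) => _ [k [p [x [h1 h2]]]].
apply: le_trans h1; rewrite lerD2l; apply: ler_sum => a _.
rewrite /Fhat_next h2 /= /lmod_subconv pairing_sum; apply: ler_sum => j _.
by rewrite ler_piMr ?sp_ge0 // uX //; exact: set_mem (valP (x a j)).
Qed.

End Observation.

(** * Limit of the iterates of the transposed dynamics *)

Section LeastFixpoint.
Context {R : realType} {A : finType} {n : nat}.
Variables (b : 'I_n -> R) (C : A -> 'I_n -> 'rV[R]_n).
Hypotheses (b_ge0 : forall j, 0 <= b j) (C_ge0 : forall a j, orthant R n (C a j)).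

Definition predual (u : 'I_n -> R) (j : 'I_n) : R :=
  b j + \sum_a pairing u (C a j).

Let U k : 'I_n -> R := iter k predual (fun=> 0).

Lemma iter_predual_le k j : U k j <= U k.+1 j.
Proof.
elim: k j => [|k IH] j /=.
  by rewrite addr_ge0 ?sumr_ge0 // => a _; apply: pairing_ge0.
by rewrite lerD2l; apply: ler_sum => a _; apply: ler_pairing.
Qed.

Lemma cvg_pairing (v : nat -> 'I_n -> R) (w : 'I_n -> R) (x : 'rV[R]_n) :
  (forall j, v k j @[k --> \oo] --> w j) ->
  pairing (v k) x @[k --> \oo] --> pairing w x.
Proof.
move=> vw; apply: (cvg_big add_continuous) => j _; apply: cvgM; [exact: vw|exact: cvg_cst].
Qed.

Lemma predual_fixpoint :
  (forall k j, U k j <= 1) ->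
  exists u : 'I_n -> R, [/\ forall j, 0 <= u j, predual u =1 u &
    forall x, (forall k, pairing (U k) x <= 1) -> pairing u x <= 1].
Proof.
move=> U1; have ndU j : nondecreasing_seq (fun k => U k j).
  by apply/nondecreasing_seqP => k; exact: iter_predual_le.
have cvgU j : cvgn (fun k => U k j).
  apply: nondecreasing_is_cvgn => //.
  by exists 1 => _ [k _ <-].
pose u j := limn (fun k => U k j).
have Uu j : U k j @[k --> \oo] --> u j by exact: cvgU.
exists u; split=> [j|j|x Ux].
- by apply: limr_ge => //; apply: nearW => k; apply: (ndU j 0).
(* The shifted sequence is a tail of [U] and also the image of [U] under [predual]; by continuity it
   tends both to [u] and to [predual b C u]. *)
- have US : U k.+1 j @[k --> \oo] --> u j.
    by rewrite (cvg_shiftS (fun k => U k j)).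
  have UP : U k.+1 j @[k --> \oo] --> predual u j.
    apply: cvgD; first exact: cvg_cst.
    by apply: (cvg_big add_continuous) => a _; exact: cvg_pairing.
  exact: cvg_unique UP US.
- have /cvg_lim <- // := @cvg_pairing U u x Uu.
  apply: limr_le; first by apply/cvg_ex; eexists; exact: cvg_pairing.
  by apply: nearW.
Qed.

End LeastFixpoint.

(** * Coalgebra structure on the weighted simplex of a u with T u <= u *)

Section WeightedSimplexCoalgebra.
Context {R : realType} {A : finType} {n : nat}.
Variables (b : 'I_n -> R) (C : A -> 'I_n -> 'rV[R]_n) (u : 'I_n -> R).
Hypotheses (b_ge0 : forall j, 0 <= b j) (C_ge0 : forall a j, orthant R n (C a j)).
Hypotheses (u_gt0 : forall j, 0 < u j) (bCu : forall j, predual b C u j <= u j).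

Let Y : pca R := sub_pca (weighted_simplex_closed u).

Definition linear_next a (x : 'rV[R]_n) : 'rV[R]_n := \sum_j x 0 j *: C a j.

(** Exchanging the sums over coordinates and letters shows that [predual] is adjoint to one step of
    the linear dynamics. Bounds on functionals thereby become bounds on points. *)
Lemma pairing_predual x :
  pairing (predual b C u) x =
  pairing b x + \sum_a pairing u (linear_next a x).
Proof.
under [X in _ = _ + X]eq_bigr do rewrite pairing_sum.
rewrite exchange_big /= -big_split /=; apply: eq_bigr => j _.
rewrite mulrDl; congr (_ + _); rewrite mulr_suml.
by apply: eq_bigr => a _; rewrite mulrC.
Qed.

Lemma linear_next_orthant a x : orthant R n x -> orthant R n (linear_next a x).
Proof. by move=> x0; apply: orthant_sum => j. Qed.

Lemma weighted_simplex_step x : weighted_simplex u x ->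
  pairing b x + \sum_a pairing u (linear_next a x) <= 1.
Proof.
move=> [x0 x1]; rewrite -pairing_predual; apply: le_trans x1.
exact: ler_pairing.
Qed.

Lemma linear_next_weighted_simplex a x :
  weighted_simplex u x -> weighted_simplex u (linear_next a x).
Proof.
move=> ux; have [x0 _] := ux; have L0 a' := linear_next_orthant a' x x0.
split; first exact: L0.
have u0 j : 0 <= u j by exact: ltW.
apply: le_trans (weighted_simplex_step _ ux).
(* The term of letter [a] is at most the whole sum, since the output and the other terms are
   nonnegative. *)
rewrite (bigD1 a) //= addrCA lerDl addr_ge0 //; first exact: pairing_ge0.
by rewrite sumr_ge0 // => a' _; exact: pairing_ge0.
Qed.

Definition simplex_next (y : Y) (a : A) : Y :=
  exist (fun y => y \in weighted_simplex u) _
    (mem_set (linear_next_weighted_simplex a _ (sub_weighted_simplex _ y))).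

Lemma simplex_step_Fhat (y : Y) :
  Fhat_set ((pairing b (val y), simplex_next y) :
    prod_pca (lmod_pca R^o) (pow_pca A Y)).
Proof.
have uy := sub_weighted_simplex _ y; have [y0 _] := uy.
have u0 j : 0 <= u j by exact: ltW.
have uy1 := weighted_simplex_step _ uy.
split=> /=.
  rewrite pairing_ge0 //=; apply: le_trans uy1; rewrite lerDl sumr_ge0 // => a _.
  by apply: pairing_ge0 => //; exact: linear_next_orthant.
(* Each successor is written in the vertices. The mass of its coordinates is its pairing with [u],
   so the required bound is [uy1]. *)
exists (fun=> n), (fun a => coord_subprob _ u_gt0 (simplex_next y a)),
  (fun=> vertex_in _ u_gt0); split; first exact: uy1.
by move=> a; symmetry; exact: coord_subprobK.
Qed.

Definition simplex_step (y : Y) : Fhat A Y :=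
  exist (fun w => w \in @Fhat_set R A Y) _ (mem_set (simplex_step_Fhat y)).

Fact simplex_step_hom m (p : subprob R m) (y : 'I_m -> Y) :
  simplex_step (subconv p y) = subconv p (fun i => simplex_step (y i)).
Proof.
apply: val_inj => /=; congr pair; first exact: pairing_sum.
apply/funext => a; apply: val_inj => /=; rewrite /linear_next.
under eq_bigr do rewrite summxE scaler_suml.
rewrite exchange_big /=; apply: eq_bigr => i _.
by rewrite scaler_sumr; apply: eq_bigr => j _; rewrite mxE scalerA.
Qed.

Definition simplex_coalg : pca_hom Y (Fhat A Y) := PcaHom simplex_step_hom.

End WeightedSimplexCoalgebra.

(** * Bounds on X, positivity of the fixed point, and the resulting extension *)

Theorem theorem19 (R : realType) (A : finType) (n : nat)
  (X : set 'rV[R]_n) (hX : subconv_closed (P := Rn_pca R n) X)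
  (c : pca_hom (sub_pca hX) (Fhat A (sub_pca hX)))
  (cptX : compact X)
  (hD : simplex R n `<=` X)
  (hP : X `<=` orthant R n)
  (hI : ~ exists I : {set 'I_n}, I != finset.set0 /\
    forall j : 'I_n, j \in I ->
      Fhat_out (c (ebase_in hX hD j)) = 0 /\
      forall a : A, val (Fhat_next (c (ebase_in hX hD j)) a)
        \in <<[seq ebase R i | i in I]>>%VS) :
  exists (Y : set 'rV[R]_n) (hY : subconv_closed (P := Rn_pca R n) Y)
    (d : pca_hom (sub_pca hY) (Fhat A (sub_pca hY)))
    (hXY : X `<=` Y),
    Y `<=` orthant R n /\
    coalg_morph c d (sub_incl hX hY hXY) /\
    exists v : n.-tuple 'rV[R]_n,
      free v /\
      Y = subconvex_hull [set` v] /\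
      exists g : 'I_n -> sub_pca hY,
        (forall i, val (g i) = tnth v i) /\ free_on g.
Proof.
pose e j := ebase_in hX hD j.
pose b j : R := Fhat_out (c (e j)).
pose C a j : 'rV[R]_n := val (Fhat_next (c (e j)) a).
have b_ge0 j : 0 <= b j by case: (set_mem (valP (c (e j)))) => /andP[].
have C_ge0 a j : orthant R n (C a j).
  by apply: hP; exact: set_mem (valP (Fhat_next (c (e j)) a)).
have outE x : Fhat_out (c x) = pairing b (val x).
  rewrite -[LHS]/(out_hom c x : R^o) (pca_hom_linear hX hD hP).
  by apply: eq_bigr => j _; rewrite mulrC.
have nextE x a : val (Fhat_next (c x) a) = linear_next C a (val x).
  by rewrite -[LHS]/(next_hom c a x : 'rV_n) (pca_hom_linear hX hD hP).
(* The bound is carried on all of X, not only on the basis vectors, because the successors are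
   combinations of arbitrary points of X. *)
have U_le1 k x : X x -> pairing (iter k (predual b C) (fun=> 0)) x <= 1.
  elim: k x => [|k IH] x Xx.
    by rewrite /pairing big1 // => j _; rewrite mul0r.
  pose x' : sub_pca hX := exist (fun x => x \in X) x (mem_set Xx).
  rewrite iterS pairing_predual; have := Fhat_pairing_le1 _ (c x') IH.
  by rewrite outE; under eq_bigr do rewrite nextE.
have [|u [u_ge0 uE u_le1]] := predual_fixpoint b C b_ge0 C_ge0.
  by move=> k j; rewrite -pairing_ebase; apply: U_le1; apply/hD/ebase_simplex.
have u_gt0 j : 0 < u j.
  rewrite lt_def u_ge0 andbT; apply/negP => /eqP uj0; apply: hI.
  exists [set i | u i == 0]%SET; split.
    by apply/set0Pn; exists j; rewrite inE uj0.
  (* If [u i = 0], the fixed-point equation writes 0 as a sum of nonnegative terms: [b i] and all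
     products [u l * C a i 0 l] vanish. *)
  move=> i; rewrite inE => /eqP ui0; move: (uE i).
  rewrite ui0 => /eqP; rewrite paddr_eq0 ?sumr_ge0 //; last first.
    by move=> a _; apply: pairing_ge0.
  case/andP => /eqP bi0; rewrite psumr_eq0; last first.
    by move=> a _; apply: pairing_ge0.
  move=> /allP Ci0; split=> // a.
  have := Ci0 a (mem_index_enum a); rewrite psumr_eq0; last first.
    by move=> l _; rewrite mulr_ge0 ?C_ge0.
  move=> /allP Cl0; rewrite [X in X \in _]row_sum_ebase.
  apply: memv_suml => l _; have := Cl0 l (mem_index_enum l).
  (* Either [l] lies in I, or the l-th coordinate of [C a i] is 0; hence [C a i] is in the span of
     the basis vectors indexed by I. *)
  rewrite mulf_eq0 => /orP[ul0|/eqP Cl]; last first.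
    by rewrite -[val _]/(C a i) Cl scale0r mem0v.
  by apply/memvZ/memv_span; apply: map_f; rewrite mem_enum inE.
have bCu j : predual b C u j <= u j by rewrite uE.
have hXY : X `<=` weighted_simplex u.
  by move=> x Xx; split; [exact: hP|apply: u_le1 => k; exact: U_le1].
exists (weighted_simplex u), (weighted_simplex_closed u),
  (simplex_coalg b C u b_ge0 C_ge0 u_gt0 bCu), hXY.
split; first by move=> x [].
split.
  move=> x; apply: val_inj => /=; congr pair; first by rewrite outE.
  by apply/funext => a; apply: val_inj; rewrite /= nextE.
exists [tuple vertex u i | i < n]; split; first exact: free_vertex.
split; first exact: subconvex_hull_vertex.
exists (vertex_in u u_gt0); split; first by move=> i; rewrite tnth_mktuple.
exact: free_on_vertex.
Qed.
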